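(* Let $K$ be an infinite field of characteristic different from $2$ and $3$, and let $A$ be a Bernstein algebra over $K$ with weight function $\omega$. Put $H=\{x\in A:\omega(x)=1\}$. (A) $A$ is algebraic if and only if all elements $x\in H$ are algebraic. (B) $A$ is algebraic of bounded degree if and only if all elements $x\in H$ are algebraic and their algebraic degrees are bounded collectively.
   Context: Algebras are not assumed associative, unital or finite-dimensional. A Bernstein algebra over $K$ is a commutative $K$-algebra $A$ with a nonzero algebra homomorphism $\omega:A\to K$ (weight function) satisfying $(x^2)^2=\omega(x)^2x^2$ for all $x$. An element $a$ is algebraic of degree $\dim\mathrm{alg}(a)$ if the subalgebra $\mathrm{alg}(a)$ generated by $a$ is finite-dimensional. $A$ is algebraic if all its elements are algebraic, and algebraic of bounded degree if in addition the degrees of all elements are bounded by a common integer. *)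

(* Defs.v *)
From HB Require Import structures.
From mathcomp Require Import all_boot all_order all_algebra.
From mathcomp Require Import boolp classical_sets functions cardinality.

Set Implicit Arguments.
Unset Strict Implicit.
Unset Printing Implicit Defensive.

Import GRing.Theory.

Local Open Scope classical_set_scope.
Local Open Scope ring_scope.

(* MathComp's algebra structures are all associative and unital, so a general
   K-algebra is given here by a left module A with a bilinear map
   mul : A -> A -> A, and a linear form on A is an element of {scalar A}. *)

Section LinearAlgebra.
Variables (K : fieldType) (A : lmodType K).

Definition lin_indep (n : nat) (v : 'I_n -> A) : Prop :=
  forall c : 'I_n -> K, \sum_(i < n) c i *: v i = 0 -> forall i, c i = 0.

Definition lin_span (n : nat) (v : 'I_n -> A) : set A :=
  [set x | exists c : 'I_n -> K, x = \sum_(i < n) c i *: v i].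

(* [vector.v] only covers subspaces of finite-dimensional spaces, so dimension
   is expressed as a relation: S has a basis of n vectors. *)
Definition has_dim (S : set A) (n : nat) : Prop :=
  exists v : 'I_n -> A, lin_indep v /\ S = lin_span v.

Definition finite_dim (S : set A) : Prop := exists n, has_dim S n.

End LinearAlgebra.

Section Algebras.
Variables (K : fieldType) (A : lmodType K) (mul : {bilinear A -> A -> A}).

Definition subalgebra (S : set A) : Prop :=
  submod_closed (mem S) /\ (forall x y, S x -> S y -> S (mul x y)).

Definition alg (a : A) : set A := smallest subalgebra [set a].

Definition algebraic_elt (a : A) : Prop := finite_dim (alg a).

Definition has_degree (a : A) (n : nat) : Prop :=
  algebraic_elt a /\ has_dim (alg a) n.

Definition all_algebraic (S : set A) : Prop :=
  forall x, S x -> algebraic_elt x.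

Definition degrees_bounded (S : set A) : Prop :=
  exists N : nat, forall x n, S x -> has_degree x n -> (n <= N)%N.

Definition algebraic_algebra : Prop := all_algebraic setT.

Definition algebraic_of_bounded_degree : Prop :=
  algebraic_algebra /\ degrees_bounded setT.

Record bernstein (omega : {scalar A}) : Prop := Bernstein {
  bernstein_mulC : forall x y, mul x y = mul y x;
  bernstein_weightM : forall x y, omega (mul x y) = omega x * omega y;
  bernstein_weight_neq0 : exists x, omega x != 0;
  bernstein_identity : forall x,
    mul (mul x x) (mul x x) = (omega x ^+ 2) *: mul x x
}.

End Algebras.

(* Main.v *)
(* Let e be an idempotent of weight 1 and A = Ke + U + V the Peirce
   decomposition, where e acts as 1/2 on U and as 0 on V. For x in the kernel
   of omega, alg x is spanned by the principal powers of x. Writing x = a + b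
   with a in U and b in V, put y = b (x x); the Peirce identities give
   a (b (b ... (b y))) = 0, so the principal powers from the third on are
   b^k . y, where b^k . denotes the k-th iterate of multiplication by b.
   For h = e + a + b of weight 1 one has h (h h) - h h = y - (b b)/2, on which
   multiplication by h acts as 1/2 + b, so that b^k . (y - (b b)/2) lies in
   alg h. For a = 0 this reads b^(k+1) . (b b) - b^k . (b b) / 2 in alg (e + b),
   which puts all the b^k . (b b) in K (b b) + alg (e + b). Hence
   alg x is contained in Kx + K (x x) + K (b b) + alg (e + b) + alg (e + a + b).
   An element of nonzero weight is a multiple of one of weight 1. *)
Require Import Defs.
From mathcomp Require Import all_boot all_order all_algebra.
From mathcomp Require Import boolp classical_sets functions cardinality.
From mathcomp Require Import ring.
Set Implicit Arguments.
Unset Strict Implicit.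
Unset Printing Implicit Defensive.

Import GRing.Theory.
Local Open Scope classical_set_scope.
Local Open Scope ring_scope.

(** * Subspaces and bounds on dimension *)

Section Dimension.
Variables (K : fieldType) (A : lmodType K).
Implicit Types (S T : set A) (x y : A).

Definition subspace S : Prop :=
  S 0 /\ forall (c : K) x y, S x -> S y -> S (c *: x + y).

Lemma submod_closedP S : submod_closed (mem S) <-> subspace S.
Proof.
split=> -[S0 Sl]; split.
- by move: S0; rewrite in_setE.
- by move=> c x y Sx Sy; have := Sl c x y; rewrite !in_setE; apply.
- by rewrite in_setE.
- by move=> c x y; rewrite !in_setE; apply: Sl.
Qed.

Lemma subspaceD S x y : subspace S -> S x -> S y -> S (x + y).
Proof. by move=> [_ Sl] Sx Sy; rewrite -[x]scale1r; apply: Sl. Qed.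

Lemma subspaceZ S c x : subspace S -> S x -> S (c *: x).
Proof. by move=> [S0 Sl] Sx; rewrite -[_ *: _]addr0; apply: Sl. Qed.

Lemma subspaceB S x y : subspace S -> S x -> S y -> S (x - y).
Proof. by move=> [_ Sl] Sx Sy; rewrite addrC -scaleN1r; apply: Sl. Qed.

Lemma lin_span_subspace n (v : 'I_n -> A) : subspace (lin_span v).
Proof.
split; first by exists (fun=> 0); rewrite big1// => i _; rewrite scale0r.
move=> c _ _ [a ->] [b ->]; exists (fun i => c * a i + b i).
rewrite scaler_sumr -big_split/=; apply: eq_bigr => i _.
by rewrite scalerDl scalerA.
Qed.

Lemma mem_lin_span n (v : 'I_n -> A) i : lin_span v (v i).
Proof.
exists (fun j => (j == i)%:R); rewrite (bigD1 i)//= eqxx scale1r big1 ?addr0//.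
by move=> j /negPf ->; rewrite scale0r.
Qed.

Lemma lin_span_min n (v : 'I_n -> A) S :
  subspace S -> (forall i, S (v i)) -> lin_span v `<=` S.
Proof.
move=> subS Sv _ [c ->]; apply: (big_ind S); first by case: subS.
  by move=> x y; apply: subspaceD.
by move=> i _; apply: subspaceZ.
Qed.

(** If n > m, the n x m matrix expressing [v] through [w] has a nonzero row vector in its left
    kernel, and this vector is a linear relation on [v]. *)
Lemma lin_indep_leq n m (v : 'I_n -> A) (w : 'I_m -> A) :
  lin_indep v -> (forall i, lin_span w (v i)) -> (n <= m)%N.
Proof.
move=> indv /choice[C vE]; rewrite leqNgt; apply/negP => lt_mn.
pose M : 'M[K]_(n, m) := \matrix_(i, j) C i j.
have /rowV0Pn[c /sub_kermxP cM0] : kermx M != 0.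
  rewrite -mxrank_eq0 mxrank_ker subn_eq0 -ltnNge.
  exact: leq_ltn_trans (rank_leq_col M) lt_mn.
suff c0 : forall i, c 0 i = 0.
  by move/eqP; apply; apply/rowP => i; rewrite c0 mxE.
apply: indv; under eq_bigr do rewrite vE scaler_sumr.
rewrite exchange_big big1//= => j _.
under eq_bigr do rewrite scalerA.
rewrite -scaler_suml; have /rowP/(_ j) := cM0; rewrite !mxE.
by under eq_bigr do rewrite mxE; move=> ->; rewrite scale0r.
Qed.

Lemma lin_indep_extend n (v : 'I_n -> A) x : lin_indep v -> ~ lin_span v x ->
  lin_indep (fun i : 'I_n.+1 => if unlift ord0 i is Some j then v j else x).
Proof.
move=> indv vNx c; rewrite big_ord_recl unlift_none.
under eq_bigr do rewrite liftK.
have [c0|c0 sum0] := eqVneq (c ord0) 0.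
  rewrite c0 scale0r add0r => /indv cl i.
  by case: (unliftP ord0 i) => [j|] ->.
exfalso; apply: vNx; exists (fun i => - (c ord0)^-1 * c (lift ord0 i)).
under eq_bigr do rewrite -scalerA; rewrite -scaler_sumr.
apply: (scalerI c0); rewrite scalerA mulrN divff// scaleN1r.
by apply/eqP; rewrite -addr_eq0 sum0.
Qed.

(** Neither independence of [v] nor equality with the span is asked for, so such bounds pass to
    subsets and to sums without any choice of bases. *)
Definition dim_le S (m : nat) : Prop :=
  exists v : 'I_m -> A, S `<=` lin_span v.

Lemma sub_dim_le S T m : S `<=` T -> dim_le T m -> dim_le S m.
Proof. by move=> sST [v Tv]; exists v; apply: subset_trans Tv. Qed.

Lemma dim_le_has_dim S m :
  subspace S -> dim_le S m -> exists2 n, (n <= m)%N & has_dim S n.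
Proof.
move=> subS [w Sw].
(* An independent family in [S] is enlarged until it spans [S]. The fuel [k] bounds the room left:
   once m <= n, a further extension would give n + 1 independent vectors in a span of m vectors. *)
suff ext k : forall n (v : 'I_n -> A), (m - n <= k)%N -> lin_indep v ->
    (forall i, S (v i)) -> exists2 n, (n <= m)%N & has_dim S n.
  by apply: (ext (m - 0)%N 0%N (fun=> 0)) => // [c _|] [].
elim: k => [|k IH] n v mn indv Sv;
    have [/asboolP vS|/asboolP/existsNP[x /not_implyP[Sx vNx]]] :=
      boolP `[< S `<=` lin_span v >].
- exists n; first by apply: lin_indep_leq indv (fun i => Sw _ (Sv i)).
  by exists v; split=> //; apply/seteqP; split=> //; apply: lin_span_min.
- suff : (n < m)%N by rewrite ltnNge -subn_eq0 -leqn0 mn.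
  apply: (lin_indep_leq (lin_indep_extend indv vNx)) => i; apply: Sw.
  by case: unliftP.
- exists n; first by apply: lin_indep_leq indv (fun i => Sw _ (Sv i)).
  by exists v; split=> //; apply/seteqP; split=> //; apply: lin_span_min.
- apply: IH (lin_indep_extend indv vNx) _.
    by rewrite subnS -ltnS; case: (m - n)%N mn.
  by move=> i; case: unliftP => [j|] _.
Qed.

Lemma dim_le_weaken S m n : (m <= n)%N -> dim_le S m -> dim_le S n.
Proof.
move=> le_mn [v Sv].
(* The family is padded with zero vectors from index [m] on. *)
exists (fun i : 'I_n => if insub (val i) is Some j then v j else 0).
apply: (subset_trans Sv); apply: lin_span_min => [|i].
  exact: lin_span_subspace.
have := mem_lin_span
  (fun i : 'I_n => if insub (val i) is Some j then v j else 0)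
  (widen_ord le_mn i).
by rewrite /= insubT// => lt_im; congr (lin_span _ (v _)); apply: val_inj.
Qed.

Definition line x : set A := [set c *: x | c in setT].

Lemma line_subspace x : subspace (line x).
Proof.
split; first by exists 0 => //; rewrite scale0r.
move=> c _ _ [a _ <-] [b _ <-]; exists (c * a + b) => //.
by rewrite scalerDl scalerA.
Qed.

Lemma mem_line x : line x x.
Proof. by exists 1 => //; rewrite scale1r. Qed.

Lemma dim_le_line x : dim_le (line x) 1.
Proof. by exists (fun=> x) => _ [c _ <-]; exists (fun=> c); rewrite big_ord1. Qed.

Definition sum_set S T : set A := [set x + y | x in S & y in T].

Lemma sum_set_subspace S T : subspace S -> subspace T -> subspace (sum_set S T).
Proof.
move=> [S0 Sl] [T0 Tl]; split; first by exists 0 => //; exists 0; rewrite ?addr0.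
move=> c _ _ [s Ss [t Tt <-]] [s' Ss' [t' Tt' <-]].
exists (c *: s + s'); first exact: Sl.
by exists (c *: t + t'); [exact: Tl | rewrite scalerDr addrACA].
Qed.

Lemma sum_set_left S T : subspace T -> S `<=` sum_set S T.
Proof. by move=> [T0 _] x Sx; exists x => //; exists 0; rewrite ?addr0. Qed.

Lemma sum_set_right S T : subspace S -> T `<=` sum_set S T.
Proof. by move=> [S0 _] x Tx; exists 0 => //; exists x; rewrite ?add0r. Qed.

Lemma dim_le_sum S T m n :
  dim_le S m -> dim_le T n -> dim_le (sum_set S T) (m + n).
Proof.
move=> [v Sv] [w Tw].
exists (fun i : 'I_(m + n) =>
  match fintype.split i with inl j => v j | inr j => w j end).
move=> _ [_ /Sv[a ->] [_ /Tw[b ->] <-]].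
exists (fun i : 'I_(m + n) =>
  match fintype.split i with inl j => a j | inr j => b j end).
rewrite big_split_ord/=; congr (_ + _); apply: eq_bigr => i _.
  by rewrite (unsplitK (inl _ i)).
by rewrite (unsplitK (inr _ i)).
Qed.

End Dimension.

(* [lmod] proves an identity between linear combinations in a module by
   reifying both sides over their common atoms and comparing coefficients. *)
Inductive lexp (K : Type) :=
  | LVar of nat | LZero | LAdd of lexp K & lexp K | LOpp of lexp K
  | LScale of K & lexp K.

Section LinearExpressions.
Variables (K : fieldType) (A : lmodType K).

Fixpoint lval (env : seq A) (t : lexp K) : A :=
  match t with
  | LVar i => env`_i
  | LZero => 0
  | LAdd s t => lval env s + lval env t
  | LOpp s => - lval env s
  | LScale c s => c *: lval env s
  end.

Fixpoint lcoef (t : lexp K) (i : nat) : K :=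
  match t with
  | LVar j => if i == j then 1 else 0
  | LZero => 0
  | LAdd s t => lcoef s i + lcoef t i
  | LOpp s => - lcoef s i
  | LScale c s => c * lcoef s i
  end.

Lemma lvalE env t :
  lval env t = \sum_(i < size env) lcoef t i *: env`_i.
Proof.
elim: t => [j||s IHs t IHt|s IHs|c s IHs] /=.
- have [ltj|lej] := ltnP j (size env); last first.
    rewrite nth_default// big1// => i _.
    by rewrite ltn_eqF ?scale0r// (leq_trans _ lej).
  rewrite (bigD1 (Ordinal ltj))//= eqxx scale1r big1 ?addr0// => i.
  by rewrite -val_eqE/= => /negPf ->; rewrite scale0r.
- by rewrite big1// => i _; rewrite scale0r.
- rewrite IHs IHt -big_split/=; apply: eq_bigr => i _; by rewrite scalerDl.
- rewrite IHs -sumrN; apply: eq_bigr => i _; by rewrite scaleNr.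
- rewrite IHs scaler_sumr; apply: eq_bigr => i _; by rewrite scalerA.
Qed.

(** A recursive conjunction instead of a bounded quantifier: on a concrete environment it computes
    to one scalar equation per atom, ready for [ring] or [field]. *)
Fixpoint all_lt (n : nat) (P : nat -> Prop) : Prop :=
  if n is n'.+1 then P n' /\ all_lt n' P else True.

Lemma lval_eq env s t :
  all_lt (size env) (fun i => lcoef s i = lcoef t i) ->
  lval env s = lval env t.
Proof.
move=> eq_st; rewrite !lvalE; apply: eq_bigr => -[i lti] _ /=.
congr (_ *: _); move: i lti; elim: (size env) eq_st => //= n IH [En /IH{}IH] i.
by rewrite ltnS leq_eqVlt => /orP[/eqP ->|/IH].
Qed.

End LinearExpressions.

Ltac lmod_index x env :=
  lazymatch env with
  | x :: _ => constr:(0%N)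
  | _ :: ?env' => let i := lmod_index x env' in constr:(i.+1)
  end.

Ltac lmod_insert x env :=
  match env with
  | context [x :: _] => env
  | _ => constr:(x :: env)
  end.

Ltac lmod_atoms t env :=
  lazymatch t with
  | 0%R => env
  | (?a + ?b)%R => let env' := lmod_atoms a env in lmod_atoms b env'
  | (- ?a)%R => lmod_atoms a env
  | (_ *: ?a)%R => lmod_atoms a env
  | _ => lmod_insert t env
  end.

Ltac lmod_reify K t env :=
  lazymatch t with
  | 0%R => constr:(@LZero K)
  | (?a + ?b)%R =>
      let a' := lmod_reify K a env in
      let b' := lmod_reify K b env in constr:(@LAdd K a' b')
  | (- ?a)%R => let a' := lmod_reify K a env in constr:(@LOpp K a')
  | (?c *: ?a)%R => let a' := lmod_reify K a env in constr:(@LScale K c a')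
  | _ => let i := lmod_index t env in constr:(@LVar K i)
  end.

Ltac lmod F A :=
  lazymatch goal with
  | |- ?s = ?t =>
    let T := type of s in
    let K := constr:(GRing.Field.sort F) in
    let env := lmod_atoms s (@nil T) in
    let env := lmod_atoms t env in
    let s' := lmod_reify K s env in
    let t' := lmod_reify K t env in
    apply: (@lval_eq F A env s' t'); rewrite /=; repeat split; try ring; try by field
  end.

(** * Linearized Bernstein identities and subalgebras with one generator *)

Section Bernstein.
Variables (K : fieldType) (A : lmodType K) (mul : {bilinear A -> A -> A}).
Variable omega : {scalar A}.
Hypotheses (two_neq0 : (2 : K) != 0) (three_neq0 : (3 : K) != 0).
Hypothesis A_bernstein : bernstein mul omega.

Local Notation "x ** y" := (mul x y) (at level 40, left associativity).

Let mulC x y : x ** y = y ** x. Proof. exact: bernstein_mulC A_bernstein _ _. Qed.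
Let mulDl x y z : (x + y) ** z = x ** z + y ** z. Proof. exact: linearDl. Qed.
Let mulDr x y z : z ** (x + y) = z ** x + z ** y. Proof. exact: linearDr. Qed.
Let mulNl x z : (- x) ** z = - (x ** z). Proof. exact: linearNl. Qed.
Let mulNr x z : z ** (- x) = - (z ** x). Proof. exact: linearNr. Qed.
Let mulZl c x z : (c *: x) ** z = c *: (x ** z). Proof. exact: linearZl_LR. Qed.
Let mulZr c x z : z ** (c *: x) = c *: (z ** x). Proof. exact: linearZr_LR. Qed.
Let mul0x x : 0 ** x = 0. Proof. exact: linear0l. Qed.
Let mulx0 x : x ** 0 = 0. Proof. exact: linear0r. Qed.
Let mulE := (mulDl, mulDr, mulNl, mulNr, mulZl, mulZr, mul0x, mulx0).
Let omegaD x y : omega (x + y) = omega x + omega y. Proof. exact: linearD. Qed.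
Let omegaN x : omega (- x) = - omega x. Proof. exact: linearN. Qed.
Let omegaZ c x : omega (c *: x) = c * omega x. Proof. exact: linearZ. Qed.
Let omegaM x y : omega (x ** y) = omega x * omega y.
Proof. exact: bernstein_weightM A_bernstein _ _. Qed.
Let omegaE := (omegaD, omegaN, omegaZ, omegaM).

(* The part of (z z)(z z) = omega(z)^2 z z at z = x + t y that is linear in t,
   extracted from the values t = 1, -1, 2. *)
Lemma bernstein_sq_mul x y : 2 *: ((x ** x) ** (x ** y)) =
  (omega x * omega y) *: (x ** x) + (omega x ^+ 2) *: (x ** y).
Proof.
pose F z := (z ** z) ** (z ** z) - (omega z ^+ 2) *: (z ** z).
have F0 z : F z = 0 by rewrite /F (bernstein_identity A_bernstein) subrr.
(* As a polynomial in t, F (x + t y) has degree 4, with constant term F x and leading coefficient F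
   y. These weights cancel degrees 0, 2, 3 and 4 and leave 6 times the linear coefficient, which is
   12 times the difference of the two sides divided by 2 in the source identity, namely the claim
   scaled by 12. *)
have : 6 *: F (x + y) - 2 *: F (x - y) - F (x + 2 *: y) - 3 *: F x
  + 12 *: F y = 0 by rewrite !F0; lmod K A.
rewrite /F !omegaE !mulE [y ** x]mulC ![(x ** y) ** (x ** x)]mulC.
rewrite ![(y ** y) ** _]mulC [(x ** y) ** (y ** y)]mulC => F12.
have twelve_neq0 : (12 : K) != 0.
  by rewrite (_ : 12 = 2 * 2 * 3) ?mulf_neq0//; ring.
apply/(scalerI twelve_neq0)/eqP; rewrite -subr_eq0 -[X in _ == X]F12; apply/eqP.
lmod K A.
Qed.

Lemma bernstein_sq_mul2 x y z :
  2 *: ((x ** x) ** (z ** y)) + 4 *: ((x ** z) ** (x ** y)) =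
  (omega z * omega y) *: (x ** x) + (2 * omega x * omega y) *: (x ** z) +
  (2 * omega x * omega z) *: (x ** y) + (omega x ^+ 2) *: (z ** y).
Proof.
pose T u := 2 *: ((u ** u) ** (u ** y)) -
  ((omega u * omega y) *: (u ** u) + (omega u ^+ 2) *: (u ** y)).
have T0 u : T u = 0 by rewrite /T bernstein_sq_mul subrr.
(* [T] is cubic: the odd part of T (x + t z) at t = 1, without its cubic term T z, is the part
   linear in z. *)
have : T (x + z) - T (x - z) - 2 *: T z = 0 by rewrite !T0; lmod K A.
rewrite /T !omegaE !mulE [z ** x]mulC => T2.
apply/(scalerI two_neq0)/eqP; rewrite -subr_eq0 -[X in _ == X]T2; apply/eqP.
lmod K A.
Qed.

Lemma bernstein_polarized x y z w :
  2 *: ((x ** w) ** (z ** y) + (x ** z) ** (w ** y) + (w ** z) ** (x ** y)) =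
  (omega z * omega y) *: (x ** w) + (omega w * omega y) *: (x ** z) +
  (omega x * omega y) *: (w ** z) + (omega w * omega z) *: (x ** y) +
  (omega x * omega z) *: (w ** y) + (omega x * omega w) *: (z ** y).
Proof.
pose D u := 2 *: ((u ** u) ** (z ** y)) + 4 *: ((u ** z) ** (u ** y)) -
  ((omega z * omega y) *: (u ** u) + (2 * omega u * omega y) *: (u ** z) +
   (2 * omega u * omega z) *: (u ** y) + (omega u ^+ 2) *: (z ** y)).
have D0 u : D u = 0 by rewrite /D bernstein_sq_mul2 subrr.
(* [D] is quadratic in [u], so this is its associated symmetric bilinear form. *)
have : D (x + w) - D x - D w = 0 by rewrite !D0; lmod K A.
rewrite /D !omegaE !mulE [w ** x]mulC => D2.
apply/(scalerI two_neq0)/eqP; rewrite -subr_eq0 -[X in _ == X]D2; apply/eqP.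
lmod K A.
Qed.

Lemma null_sq_mul x y : omega x = 0 -> (x ** x) ** (x ** y) = 0.
Proof.
move=> x0; apply: (scalerI two_neq0).
by rewrite bernstein_sq_mul x0 mul0r expr0n !scale0r addr0 scaler0.
Qed.

Lemma null_sq_mul2 x y z : omega x = 0 -> omega y = 0 ->
  (x ** x) ** (z ** y) + 2 *: ((x ** z) ** (x ** y)) = 0.
Proof.
move=> x0 y0; apply: (scalerI two_neq0).
have := bernstein_sq_mul2 x y z; rewrite x0 y0 => xyz.
transitivity (2 *: ((x ** x) ** (z ** y)) + 4 *: ((x ** z) ** (x ** y))).
  by lmod K A.
by rewrite xyz; lmod K A.
Qed.

(** Principal powers with the exponent shifted by one: [ppow x k] is x^(k+1). *)
Definition ppow x k : A := iter k (mul x) x.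

(** If one factor is x x, this is [null_sq_mul]. Otherwise [null_sq_mul2] expresses the product
    through x x times the product of the two preceding powers, which vanishes by induction. *)
Lemma ppow_mul x i j : omega x = 0 -> ppow x i.+1 ** ppow x j.+1 = 0.
Proof.
move=> x0; have w0 k : omega (ppow x k) = 0.
  by case: k => //= k; rewrite omegaM x0 mul0r.
elim: i j => [|i IH] [|j]; rewrite /= ?null_sq_mul// 1?mulC ?null_sq_mul//.
apply: (scalerI two_neq0); rewrite scaler0.
have := null_sq_mul2 (mul x (ppow x j)) x0 (w0 i.+1).
by rewrite [_ ** ppow x i.+1]mulC IH !mulx0 add0r.
Qed.

Lemma algP x y : alg mul x y <->
  forall S, subspace S -> (forall y z, S y -> S z -> S (y ** z)) -> S x -> S y.
Proof.
split=> [xy S subS Smul Sx|xy S [[/submod_closedP subS Smul] Sx]].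
  apply: (xy S); split; last by move=> _ ->.
  by split=> //; apply/submod_closedP.
by apply: xy => //; apply: Sx.
Qed.

Lemma alg_subspace x : subspace (alg mul x).
Proof.
split=> [|c y z /algP xy /algP xz]; apply/algP => S subS Smul Sx.
  exact: subS.1.
exact: subS.2 (xy _ subS Smul Sx) (xz _ subS Smul Sx).
Qed.

Lemma alg_mul x y z : alg mul x y -> alg mul x z -> alg mul x (y ** z).
Proof.
move=> /algP xy /algP xz; apply/algP => S subS Smul Sx.
exact: Smul (xy _ subS Smul Sx) (xz _ subS Smul Sx).
Qed.

Lemma alg_id x : alg mul x x. Proof. exact/algP. Qed.

Lemma alg_min x S : subspace S -> (forall y z, S y -> S z -> S (y ** z)) ->
  S x -> alg mul x `<=` S.
Proof. by move=> subS Smul Sx y /algP; apply. Qed.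

(** The span of the principal powers is closed under multiplication: x times a power is the next
    power, and all other products of powers vanish by [ppow_mul]. *)
Lemma alg_sub_ppow x S : omega x = 0 -> subspace S ->
  (forall k, S (ppow x k)) -> alg mul x `<=` S.
Proof.
move=> x0 subS Sx.
(* The span of all principal powers, as an intersection of subspaces. *)
pose P : set A := [set z | forall T : set A,
  subspace T -> (forall k, T (ppow x k)) -> T z].
have subP : subspace P.
  split=> [T [] //|c y z Py Pz T subT Tx].
  by apply: subT.2; [apply: Py | apply: Pz].
have Px k : P (ppow x k) by move=> T _; apply.
suff Pmul y z : P y -> P z -> P (y ** z).
  by move=> y /(alg_min subP Pmul (Px 0%N)) Py; apply: Py.
(* By bilinearity each factor in turn may be replaced by a principal power. *)
move=> Py Pz; apply: (Py [set y | P (y ** z)]) => [|i].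
  split=> [|c u v Pu Pv] /=; first by rewrite mul0x; apply: subP.1.
  by rewrite !mulE; apply: subP.2.
apply: (Pz [set z | P (ppow x i ** z)]) => [|j].
  split=> [|c u v Pu Pv] /=; first by rewrite mulx0; apply: subP.1.
  by rewrite !mulE; apply: subP.2.
rewrite /=; case: i => [|i]; first exact: (Px j.+1).
case: j => [|j]; first by rewrite mulC; exact: (Px i.+2).
by rewrite ppow_mul//; apply: subP.1.
Qed.

(** * Peirce decomposition at an idempotent of weight 1 *)

Section Peirce.
Variable e : A.
Hypotheses (ee : e ** e = e) (omega_e : omega e = 1).

Definition peirceU : set A := [set u | e ** u = 2^-1 *: u].
Definition peirceV : set A := [set v | e ** v = 0].

Lemma peirceU_subspace : subspace peirceU.
Proof.
split=> [|c x y xU yU]; rewrite /peirceU /= ?mulx0 ?scaler0// !mulE xU yU.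
by lmod K A.
Qed.

Lemma peirceU_weight u : peirceU u -> omega u = 0.
Proof.
move=> /(congr1 (fun x => 2 * omega x)); rewrite omegaM omegaZ omega_e mul1r.
rewrite mulrA divff// mul1r => /(congr1 (fun c => c - omega u)).
by rewrite subrr => <-; ring.
Qed.

Lemma peirceV_weight v : peirceV v -> omega v = 0.
Proof. by move=> /(congr1 omega); rewrite omegaM omega_e mul1r (linear0 omega). Qed.

(** On the kernel of [omega], multiplication L by [e] satisfies L L = L/2, so 2 L is a projection
    onto U along V. *)
Lemma peirce_decomposition x : omega x = 0 ->
  exists u v, [/\ peirceU u, peirceV v & x = u + v].
Proof.
move=> x0; have eex : e ** (e ** x) = 2^-1 *: (e ** x).
  apply: (scalerI two_neq0); rewrite -{1}ee bernstein_sq_mul omega_e x0 ee.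
  by lmod K A.
exists (2 *: (e ** x)), (x - 2 *: (e ** x)); split; last by rewrite addrC subrK.
  by rewrite /peirceU /= !mulE eex; lmod K A.
by rewrite /peirceV /= !mulE eex; lmod K A.
Qed.

(** Source of the inclusions of U U in V, of U V in U and of V V in U. *)
Lemma peirce_mul2 x y : omega x = 0 -> omega y = 0 ->
  2 *: (e ** (x ** y)) + 4 *: ((e ** x) ** (e ** y)) = x ** y.
Proof.
move=> x0 y0; have := bernstein_sq_mul2 e y x.
by rewrite ee omega_e x0 y0 => ->; lmod K A.
Qed.

(** Substituting elements of U and V for the variables yields the cubic relations below, from
    [peirceU_VV] to [peirceU_cube]. *)
Lemma peirce_mul3 x y z : omega x = 0 -> omega y = 0 -> omega z = 0 ->
  (e ** x) ** (y ** z) + (e ** y) ** (x ** z) + (e ** z) ** (x ** y) = 0.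
Proof.
move=> x0 y0 z0; apply: (scalerI two_neq0).
have := bernstein_polarized e z y x; rewrite omega_e x0 y0 z0.
by rewrite [(x ** y) ** _]mulC => ->; lmod K A.
Qed.

Lemma peirceUU u u' : peirceU u -> peirceU u' -> peirceV (u ** u').
Proof.
move=> uU u'U; apply: (scalerI two_neq0).
have := peirce_mul2 (peirceU_weight uU) (peirceU_weight u'U).
by rewrite uU u'U !mulE => /(canRL (addrK _)) ->; lmod K A.
Qed.

Lemma peirceUV u v : peirceU u -> peirceV v -> peirceU (u ** v).
Proof.
move=> uU vV; apply: (scalerI two_neq0).
have := peirce_mul2 (peirceU_weight uU) (peirceV_weight vV).
by rewrite vV !mulE => /(canRL (addrK _)) ->; lmod K A.
Qed.

Lemma peirceVV v v' : peirceV v -> peirceV v' -> peirceU (v ** v').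
Proof.
move=> vV v'V; apply: (scalerI two_neq0).
have := peirce_mul2 (peirceV_weight vV) (peirceV_weight v'V).
by rewrite vV !mulE => /(canRL (addrK _)) ->; lmod K A.
Qed.

Lemma peirceU_VV u v v' : peirceU u -> peirceV v -> peirceV v' ->
  u ** (v ** v') = 0.
Proof.
move=> uU vV v'V; apply: (scalerI (invr_neq0 two_neq0)).
have := peirce_mul3 (peirceU_weight uU) (peirceV_weight vV) (peirceV_weight v'V).
by rewrite uU vV v'V !mulE => /(canRL (addrK _))/(canRL (addrK _)) ->; lmod K A.
Qed.

Lemma peirceUUV u u' v : peirceU u -> peirceU u' -> peirceV v ->
  u ** (u' ** v) + u' ** (u ** v) = 0.
Proof.
move=> uU u'U vV; apply: (scalerI (invr_neq0 two_neq0)).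
have := peirce_mul3 (peirceU_weight uU) (peirceU_weight u'U) (peirceV_weight vV).
by rewrite uU u'U vV !mulE scalerDr addr0 => ->; rewrite scaler0.
Qed.

Lemma peirceUU_V u v : peirceU u -> peirceV v -> u ** (u ** v) = 0.
Proof.
move=> uU vV; apply: (scalerI two_neq0); rewrite scaler0.
by rewrite -[RHS](peirceUUV uU uU vV); lmod K A.
Qed.

Lemma peirceUUU u u' : peirceU u -> peirceU u' ->
  u' ** (u ** u) + 2 *: (u ** (u' ** u)) = 0.
Proof.
move=> uU u'U; apply: (scalerI (invr_neq0 two_neq0)).
have u0 := peirceU_weight uU.
have := peirce_mul3 (peirceU_weight u'U) u0 u0.
by rewrite uU u'U !mulE scaler0 => <-; lmod K A.
Qed.

Lemma peirceU_cube u : peirceU u -> u ** (u ** u) = 0.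
Proof.
move=> uU; apply: (scalerI three_neq0); rewrite scaler0.
by rewrite -[RHS](peirceUUU uU uU); lmod K A.
Qed.

(** By [null_sq_mul2], twice this square is -(u u)(v v). As v v lies in U, [peirceUUU] turns (u u)(v
    v) into a multiple of u (u (v v)), and u (v v) = 0. *)
Lemma peirceUV_sq u v : peirceU u -> peirceV v -> (u ** v) ** (u ** v) = 0.
Proof.
move=> uU vV; have vvU := peirceVV vV vV.
have := peirceUUU uU vvU; rewrite [(v ** v) ** u]mulC (peirceU_VV uU vV vV) mulx0 scaler0.
rewrite addr0 mulC => uuvv; apply: (scalerI two_neq0); rewrite scaler0.
have := null_sq_mul2 v (peirceU_weight uU) (peirceV_weight vV).
by rewrite uuvv add0r.
Qed.

(** * Iterated multiplication by an element of V *)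

Section Powers.
Variable b : A.
Hypothesis bV : peirceV b.

Definition mulb k x : A := iter k (mul b) x.

Lemma mulb_linear k c x y : mulb k (c *: x + y) = c *: mulb k x + mulb k y.
Proof. by elim: k => //= k ->; rewrite !mulE. Qed.

Lemma mulb0 k : mulb k 0 = 0.
Proof. by elim: k => //= k ->; rewrite mulx0. Qed.

Lemma mulbU k x : peirceU x -> peirceU (mulb k x).
Proof. by move=> xU; elim: k => //= k IH; rewrite mulC; apply: peirceUV. Qed.

(* Up to sign, multiplication by b is self-adjoint on U; iterating this reduces
   a (b^k . a) to (u b)(u b) or u (u b) for some u in U. *)
Lemma mulb_adjoint a x : peirceU a -> peirceU x ->
  a ** (b ** x) = - ((b ** a) ** x).
Proof.
move=> aU xU; rewrite [b ** x]mulC [_ ** x]mulC [b ** a]mulC.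
by apply/eqP; rewrite -addr_eq0 peirceUUV.
Qed.

Lemma mulb_VV_annihilated k a c : peirceU a -> peirceV c ->
  a ** mulb k (b ** c) = 0.
Proof.
(* The induction is over all [a] in U, because moving one [b] across replaces [a] by b a. *)
move=> aU cV; elim: k a aU => [|k IH] a aU; first exact: peirceU_VV.
rewrite mulb_adjoint// ?IH ?oppr0//; last exact/mulbU/peirceVV.
by rewrite mulC; apply: peirceUV.
Qed.

Lemma mulb_self_annihilated k a : peirceU a -> a ** mulb k.+1 a = 0.
Proof.
(* Moving one [b] across turns the case [k.+2] for [a] into the case [k] for b a; hence strong
   induction with two base cases. *)
have [n] := ubnP k; elim: n k a => // n IH [|[|k]] a /= ltkn aU.
- by rewrite [b ** a]mulC peirceUU_V.
- rewrite mulb_adjoint//; last by rewrite mulC; apply: peirceUV.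
  by rewrite [b ** a]mulC peirceUV_sq ?oppr0.
have baU : peirceU (b ** a) by rewrite mulC; apply: peirceUV.
rewrite mulb_adjoint//; last exact: (mulbU k.+2 aU).
have -> : mul b (mul b (mulb k a)) = mulb k.+1 (b ** a) by rewrite /mulb -iterSr.
by rewrite IH ?oppr0//; apply: ltnW.
Qed.

Section Element.
Variable a : A.
Hypothesis aU : peirceU a.

Let n := a + b.
Let y := b ** (n ** n).

Lemma annihilated_subspace : subspace [set x | forall k, a ** mulb k x = 0].
Proof.
split=> [k|c x z ax az k] /=; first by rewrite mulb0 mulx0.
by rewrite mulb_linear !mulE ax az scaler0 addr0.
Qed.

(** Expanding, y = b (a a) + 2 b (b a) + b (b b). The outer terms are iterates of [b] on products of
    two elements of V, since a a lies in V; the middle one is an iterate of [b] on [a] itself. *)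
Lemma mulb_mul_sq_annihilated k : a ** mulb k y = 0.
Proof.
have aaV := peirceUU aU aU.
have -> : y = b ** (a ** a) + 2 *: mulb 2 a + b ** b ** b.
  by rewrite /y /n !mulE [a ** b]mulC [b ** b ** b]mulC /=; lmod K A.
move: k; apply: (subspaceD annihilated_subspace).
  apply: (subspaceD annihilated_subspace) => [k|].
    exact: mulb_VV_annihilated.
  apply: (subspaceZ _ annihilated_subspace) => k.
  rewrite [mulb k _](_ : _ = mulb k.+2 a); first exact: mulb_self_annihilated.
  by rewrite /mulb -iterD addn2.
move=> k; rewrite [b ** b ** b]mulC.
rewrite [mulb k _](_ : _ = mulb k.+1 (b ** b)); last by rewrite /mulb iterSr.
exact: mulb_VV_annihilated.
Qed.

Lemma peirceU_mul_sq : peirceU y.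
Proof.
have subU := peirceU_subspace.
have -> : y = b ** (a ** a) + (2 *: ((a ** b) ** b) + (b ** b) ** b).
  by rewrite /y /n !mulE [b ** a]mulC ![(_ ** _) ** b]mulC; lmod K A.
apply: (subspaceD subU); first exact/peirceVV/peirceUU.
apply: (subspaceD subU); first exact/(subspaceZ _ subU)/peirceUV/bV/peirceUV.
exact/peirceUV/bV/peirceVV.
Qed.

(** The products a (a a), a (a b) and a (b b) all vanish, so the third power of [n] is already [y].
    From there on [a] annihilates every power, and multiplication by [n] is multiplication by
    [b]. *)
Lemma ppow_sum k : ppow n k.+2 = mulb k y.
Proof.
have nn : n ** (n ** n) = y.
  suff -> : y = a ** (n ** n) + y by rewrite -mulDl.
  rewrite (_ : a ** (n ** n) = 0) ?add0r// /n !mulE [b ** a]mulC.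
  by rewrite peirceU_cube// (peirceUU_V aU bV) (peirceU_VV aU bV bV) !addr0.
elim: k => [|k IH]; first exact: nn.
by rewrite -[ppow n k.+3]/(n ** ppow n k.+2) IH mulDl mulb_mul_sq_annihilated add0r.
Qed.

Lemma mulb_mem_alg k :
  alg mul (e + a + b) (mulb k (y - 2^-1 *: (b ** b))).
Proof.
set x := e + a + b; set w := y - _.
have bbU := peirceVV bV bV; have subx := alg_subspace x.
have wU : peirceU w.
  by apply: (subspaceB peirceU_subspace peirceU_mul_sq); apply: subspaceZ bbU; apply: peirceU_subspace.
have aw j : a ** mulb j w = 0.
  suff : [set x | forall k, a ** mulb k x = 0] w by apply.
  apply: (subspaceB annihilated_subspace); first exact: mulb_mul_sq_annihilated.
  apply: (subspaceZ _ annihilated_subspace) => i; exact: mulb_VV_annihilated.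
elim: k => [|k IH].
  have xE : x = e + n by rewrite /n addrA.
  have en : e ** n = 2^-1 *: a by rewrite /n mulDr aU bV addr0.
  have nnE : n ** n = a ** a + 2 *: (a ** b) + b ** b.
    by rewrite /n !mulE [b ** a]mulC; lmod K A.
  have enn : e ** (n ** n) = a ** b + 2^-1 *: (b ** b).
    rewrite nnE !mulE (peirceUU aU aU) (peirceUV aU bV) bbU; lmod K A.
  have na : n ** a = a ** a + a ** b by rewrite /n mulDl [b ** a]mulC.
  have xx : x ** x = e + a + n ** n.
    by rewrite xE [LHS]mulDr ![(e + n) ** _]mulDl ee en [n ** e]mulC en; lmod K A.
  (* In x (x x) the terms e, a, a a and 2 a b are the same as in x x and cancel; what remains is y +
     (b b)/2 - b b. *)
  have -> : mulb 0 w = x ** (x ** x) - x ** x.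
    rewrite xx xE [(e + n) ** _]mulDl ![_ ** (e + a + _)]mulDr ![_ ** (e + a)]mulDr.
    rewrite ee aU enn [n ** e]mulC en na [n ** (n ** n)](ppow_sum 0) nnE.
    by rewrite /w /=; lmod K A.
  by apply: (subspaceB subx); do !apply: alg_mul; apply: alg_id.
(* On this element of U, [e] acts as 1/2 and [a] as 0, so subtracting half of it isolates the action
   of [b]. *)
have -> : mulb k.+1 w = x ** mulb k w - 2^-1 *: mulb k w.
  rewrite !mulDl (mulbU k wU) aw /=; lmod K A.
apply: (subspaceB subx); last exact: (subspaceZ _ subx).
by apply: alg_mul => //; apply: alg_id.
Qed.
End Element.

Lemma dim_le_alg_null a m0 m1 : peirceU a ->
  dim_le (alg mul (e + b)) m0 -> dim_le (alg mul (e + a + b)) m1 ->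
  dim_le (alg mul (a + b)) (1 + (1 + (1 + (m0 + m1)))).
Proof.
move=> aU dim0 dim1; set n := a + b; set y := b ** (n ** n).
set S0 := alg mul (e + b) in dim0; set S1 := alg mul (e + a + b) in dim1.
have sub0 : subspace S0 by apply: alg_subspace.
have sub1 : subspace S1 by apply: alg_subspace.
have sub01 := sum_set_subspace sub0 sub1.
have subb := sum_set_subspace (line_subspace (b ** b)) sub01.
pose Q := sum_set (line (b ** b)) (sum_set S0 S1).
have S0Q : S0 `<=` Q.
  apply: subset_trans (sum_set_left sub1) _.
  exact: sum_set_right (line_subspace _).
have S1Q : S1 `<=` Q.
  apply: subset_trans (sum_set_right sub0) _.
  exact: sum_set_right (line_subspace _).
have bbQ k : Q (mulb k (b ** b)).
  elim: k => [|k IH]; first exact/(sum_set_left sub01)/mem_line.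
  have : Q (mulb k (b ** (b ** b) - 2^-1 *: (b ** b))).
    (* [mulb_mem_alg] is applied with a = 0, which lies in U; then [y] becomes b (b b). *)
    apply: S0Q; have := mulb_mem_alg (peirceU_subspace).1 k.
    by rewrite addr0 add0r.
  rewrite addrC -scaleNr mulb_linear.
  rewrite [mulb k (b ** (b ** b))](_ : _ = mulb k.+1 (b ** b)); last by rewrite /mulb iterSr.
  move=> /(subspaceD subb (subspaceZ 2^-1 subb IH)).
  by congr Q; lmod K A.
(* Adding back half of b^k . (b b), known to lie in [Q], to the element supplied by [S1]. *)
have yQ k : Q (mulb k y).
  have := subspaceZ 2^-1 subb (bbQ k).
  move=> /(subspaceD subb (S1Q _ (mulb_mem_alg aU k))).
  rewrite addrC -/n -/y [y - _]addrC -scaleNr mulb_linear.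
  by congr Q; lmod K A.
have subQ1 := sum_set_subspace (line_subspace (n ** n)) subb.
apply: (@sub_dim_le _ _ _ (sum_set (line n) (sum_set (line (n ** n)) Q))).
  apply: alg_sub_ppow => [||[|[|k]]].
  - by rewrite omegaD (peirceU_weight aU) (peirceV_weight bV) addr0.
  - exact: sum_set_subspace (line_subspace _) subQ1.
  - exact/(sum_set_left subQ1)/mem_line.
  - apply: (sum_set_right (line_subspace _)).
    exact/(sum_set_left subb)/mem_line.
  - rewrite ppow_sum//; apply: (sum_set_right (line_subspace _)).
    exact: (sum_set_right (line_subspace _)).
by do !apply: dim_le_sum => //; apply: dim_le_line.
Qed.

End Powers.
End Peirce.

(** * Bounding every generated subalgebra by two of weight 1 *)

Lemma bernstein_idempotent : exists2 e, e ** e = e & omega e = 1.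
Proof.
have [x x_neq0] := bernstein_weight_neq0 A_bernstein.
pose h := (omega x)^-1 *: x.
have h1 : omega h = 1 by rewrite omegaZ mulVf.
(* For weight 1 the Bernstein identity says exactly that h h is idempotent. *)
exists (h ** h); last by rewrite omegaM h1 mulr1.
by rewrite (bernstein_identity A_bernstein) h1 expr1n scale1r.
Qed.

(** The witnesses depend on [x] alone and the bound on [m0] and [m1] alone, so this serves both
    plain algebraicity and bounded degree. *)
Lemma dim_le_alg x : exists h0 h1, [/\ omega h0 = 1, omega h1 = 1 &
  forall m0 m1, dim_le (alg mul h0) m0 -> dim_le (alg mul h1) m1 ->
    dim_le (alg mul x) (1 + (1 + (1 + (m0 + m1))))].
Proof.
have [x0|x_neq0] := eqVneq (omega x) 0.
  have [e ee omega_e] := bernstein_idempotent.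
  have [u [v [uU vV ->]]] := peirce_decomposition ee omega_e x0.
  exists (e + v), (e + u + v); split=> [||m0 m1].
  - by rewrite omegaD omega_e (peirceV_weight omega_e vV) addr0.
  - rewrite !omegaD omega_e (peirceU_weight omega_e uU).
    by rewrite (peirceV_weight omega_e vV) !addr0.
  - exact: dim_le_alg_null.
pose h := (omega x)^-1 *: x; have h1 : omega h = 1 by rewrite omegaZ mulVf.
(* Here alg x lies in alg h, so one witness would do; it is repeated to fit the common bound. *)
exists h, h; split=> // m0 m1 dim0 _.
have subh := alg_subspace h.
apply: (@sub_dim_le _ _ _ (alg mul h)).
  apply: alg_min => //; first exact: alg_mul.
  have -> : x = omega x *: h by rewrite scalerA divff// scale1r.
  by apply: (subspaceZ _ subh); apply: alg_id.
apply: dim_le_weaken dim0.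
by rewrite !addnA addnAC leq_addl.
Qed.

End Bernstein.

(** * Degrees, and the two equivalences *)

Lemma algebraic_eltP (K : fieldType) (A : lmodType K)
    (mul : {bilinear A -> A -> A}) (x : A) :
  algebraic_elt mul x <-> exists m, dim_le (alg mul x) m.
Proof.
split=> [[m [v [_ ->]]]|[m dimx]]; first by exists m, v.
have [n _ dimn] := dim_le_has_dim (alg_subspace mul x) dimx.
by exists n.
Qed.

Lemma degree_leq (K : fieldType) (A : lmodType K)
    (mul : {bilinear A -> A -> A}) (x : A) (m n : nat) :
  has_degree mul x n -> dim_le (alg mul x) m -> (n <= m)%N.
Proof.
move=> [_ [v [indv algE]]] [w algw]; apply: (lin_indep_leq indv) => i.
by apply: algw; rewrite algE; apply: mem_lin_span.
Qed.

Theorem proposition2p20 (K : fieldType) (K_infinite : infinite_set [set: K])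
    (K_char2 : 2%N \notin [pchar K]) (K_char3 : 3%N \notin [pchar K])
    (A : lmodType K) (mul : {bilinear A -> A -> A}) (omega : {scalar A})
    (A_bernstein : bernstein mul omega) :
  let H := [set x : A | omega x = 1] in
  (algebraic_algebra mul <-> all_algebraic mul H) /\
  (algebraic_of_bounded_degree mul <->
     all_algebraic mul H /\ degrees_bounded mul H).
Proof.
move=> H.
have two_neq0 : (2 : K) != 0 by move: K_char2; rewrite inE.
have three_neq0 : (3 : K) != 0 by move: K_char3; rewrite inE.
have dimA := dim_le_alg two_neq0 three_neq0 A_bernstein.
have algA : all_algebraic mul H -> algebraic_algebra mul.
  move=> algH x _; have [h0 [h1 [h0H h1H dimx]]] := dimA x.
  have /algebraic_eltP[m0 dim0] := algH h0 h0H.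
  have /algebraic_eltP[m1 dim1] := algH h1 h1H.
  apply/algebraic_eltP; exists (1 + (1 + (1 + (m0 + m1))))%N; exact: dimx.
split; first by split=> // algA' x _; apply: algA'.
split=> [[algA' [N degN]]|[algH [N degN]]].
  split; first by move=> x _; apply: algA'.
  by exists N => x n _; apply: degN.
split; first exact: algA.
have dimH h : H h -> dim_le (alg mul h) N.
  move=> hH; have algh := algH h hH; have [n dimh] := algh.
  have le_nN := degN h n hH (conj algh dimh).
  by apply: dim_le_weaken le_nN _; have [v [_ ->]] := dimh; exists v.
(* Both weight 1 witnesses have degree at most [N], so 2 N + 3 bounds all degrees. *)
exists (1 + (1 + (1 + (N + N))))%N => x n _ degx.
have [h0 [h1 [h0H h1H dimx]]] := dimA x.
by apply: (degree_leq degx); apply: dimx; apply: dimH.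
Qed.
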